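(* Let $P$ be an accept-reject-based (ARB) Markov kernel on $(\Omega,\mathcal{B}(\Omega))$ with invariant probability measure $\Pi$ supported on $\Theta\subseteq\Omega$ and acceptance probability $A(\cdot)$. Then for every positive integer $t$ and every $\theta\in\Theta$, $$\|P^t(\theta,\cdot)-\Pi\|_{\mathrm{TV}}\ \ge\ [1-A(\theta)]^t.$$
   Context: $\Omega$ is a nonempty Borel measurable space with Borel sigma-algebra $\mathcal{B}(\Omega)$. $\Pi$ is a probability measure on $(\Omega,\mathcal{B}(\Omega))$ supported on a nonempty measurable set $\Theta\subseteq\Omega$, having density $\pi$ with respect to a sigma-finite measure $\lambda$ on $(\Omega,\mathcal{B}(\Omega))$; the support of $\pi$ is $\Theta$, so $\pi(\theta)>0$ for each $\theta\in\Theta$. For each $\theta\in\Theta$, $\{\theta\}$ is Borel measurable with $\lambda(\{\theta\})=0$, and $\lambda$ is strictly positive: $\lambda(U)>0$ for all nonempty measurable open sets $U\subseteq\Theta$. ARB kernel: for each $\theta\in\Omega$, $Q(\theta,\cdot)$ is a proposal distribution on $(\Omega,\mathcal{B}(\Omega))$ with density $q(\theta,\cdot)$ with respect to $\lambda$. Given an acceptance function $a:\Omega\times\Omega\to[0,1]$, the acceptance probability is $A(\theta)=\int a(\theta,\theta')q(\theta,\theta')\,d\lambda(\theta')$, and the ARB Markov kernel is $$P(\theta,B)=\int_B a(\theta,\theta')q(\theta,\theta')\,d\lambda(\theta')+\delta_\theta(B)[1-A(\theta)],\qquad \theta\in\Omega,\ B\in\mathcal{B}(\Omega),$$ where $\delta_\theta$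 is the Dirac measure at $\theta$. It is assumed that $a$ is such that $\Pi$ is invariant for $P$ (reversibility is not assumed). $P^t$ denotes the $t$-step kernel, $P^1=P$. Total variation: $\|\mu-\nu\|_{\mathrm{TV}}=\sup_f\left[\int f\,d\mu-\int f\,d\nu\right]$, the supremum over Borel measurable $f:\Omega\to[0,1]$. *)

(* Defs.v *)
From mathcomp Require Import all_boot all_order all_algebra.
From mathcomp Require Import all_classical all_reals all_analysis.

Set Implicit Arguments.
Unset Strict Implicit.
Unset Printing Implicit Defensive.

Import Order.TTheory GRing.Theory Num.Theory.

Local Open Scope classical_set_scope.
Local Open Scope ring_scope.
Local Open Scope ereal_scope.

(* The carrier of [T] equipped with the sigma-algebra generated by its open
   sets; [ptopologicalType] provides a point, so the space is nonempty. *)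
Notation borelType T := (g_sigma_algebraType (@open T)).

Section definitions.
Context d (T : measurableType d) (R : realType).

Definition is_density (lambda mu : {measure set T -> \bar R}) (f : T -> R) :=
  [/\ measurable_fun [set: T] f, forall x, (0 <= f x)%R &
      forall B, measurable B -> mu B = \int[lambda]_(x in B) (f x)%:E].

(* The supremum is taken in \bar R, so that it has no junk value; for
   probability measures it lies in [0, 1]. *)
Definition tv_dist (mu nu : {measure set T -> \bar R}) : \bar R :=
  ereal_sup [set \int[mu]_x (f x)%:E - \int[nu]_x (f x)%:E |
             f in [set f : T -> R | measurable_fun [set: T] f /\
                                    forall x, (0 <= f x <= 1)%R]].

Definition invariant_measure (P : R.-pker T ~> T)
    (mu : {measure set T -> \bar R}) :=
  forall B, measurable B -> mu B = \int[mu]_x P x B.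

(* P^0 is the identity kernel, P^(t+1)(x, B) = \int P(x, dy) P^t(y, B). *)
Fixpoint kernel_pow (P : R.-pker T ~> T) (t : nat) : R.-spker T ~> T :=
  if t is t'.+1 then mkcomp_noparam P (kernel_pow P t')
  else kdirac (@measurable_id _ T [set: T]).

Lemma kernel_pow1 (P : R.-pker T ~> T) x B : measurable B ->
  kernel_pow P 1 x B = P x B.
Proof.
move=> mB; rewrite /kernel_pow /mkcomp_noparam /= /kcomp_noparam /kdirac /=.
by rewrite integral_indic// setIT.
Qed.

Definition acceptance_prob (lambda : {measure set T -> \bar R})
    (q a : T -> T -> R) (x : T) : \bar R :=
  \int[lambda]_y (a x y * q x y)%:E.

Definition is_arb_kernel (lambda : {measure set T -> \bar R})
    (q a : T -> T -> R) (P : R.-pker T ~> T) :=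
  forall x B, measurable B ->
    P x B = \int[lambda]_(y in B) (a x y * q x y)%:E
            + \d_x B * (1 - acceptance_prob lambda q a x).

End definitions.

(* Main.v *)
Require Import Defs.
From mathcomp Require Import all_boot all_order all_algebra.
From mathcomp Require Import all_classical all_reals all_analysis measurable_realfun.

Set Implicit Arguments.
Unset Strict Implicit.
Unset Printing Implicit Defensive.

Import Order.TTheory GRing.Theory Num.Theory.

Local Open Scope classical_set_scope.
Local Open Scope ring_scope.
Local Open Scope ereal_scope.

(** The chain can stand still. Because [lambda] does not charge [{theta}], the
accept part of [P theta] does not charge it either, so [P theta {theta}] is
exactly the rejection probability [1 - A(theta)]: the atom [delta_theta] is the
only source of mass there ([arb_kernel_set1]). Rejecting [t] times in a row is
one way of being at [theta] at time [t], hence [P^t theta {theta}] is at least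
[(1 - A(theta))^t] ([kernel_pow_set1_ge]). The target [Pi], on the other hand,
has a density with respect to [lambda] and so gives [{theta}] mass [0]
([is_density_null]). Testing the total variation distance on the event
[{theta}] ([tv_dist_ge_event]) gives the bound. *)

Section total_variation_lower_bound.
Context d (T : measurableType d) (R : realType).
Implicit Types (lambda mu nu : {measure set T -> \bar R}) (B : set T) (x : T).

Lemma tv_dist_ge_event mu nu B : measurable B -> mu B - nu B <= tv_dist mu nu.
Proof.
move=> mB; apply: ereal_sup_ubound; exists \1_B.
  split; first exact: measurable_indic.
  by move=> x; rewrite indicE; case: (x \in B); rewrite ?lexx ?ler01.
by rewrite /= !integral_indic// setIT.
Qed.

Lemma is_density_null lambda mu (f : T -> R) B :
  is_density lambda mu f -> measurable B -> lambda B = 0 -> mu B = 0.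
Proof.
move=> [mf _ muE] mB B0; rewrite muE//; apply: null_set_integral => //.
by apply/measurable_EFinP; exact: measurable_funTS.
Qed.

(** Staying at [x] during [t] steps is one of the ways of being at [x] at time
[t]: restrict the first step of the Chapman-Kolmogorov integral to [{x}]. *)
Lemma kernel_pow_set1_ge (P : R.-pker T ~> T) x t : measurable [set x] ->
  P x [set x] ^+ t <= kernel_pow P t x [set x].
Proof.
move=> mx; elim: t => [|t IH].
  by rewrite expe0 /= /kdirac /= diracE mem_set.
rewrite expeS; set k := kernel_pow P t in IH *.
have -> : kernel_pow P t.+1 x [set x] = \int[P x]_y k y [set x] by [].
apply: (@le_trans _ _ (\int[P x]_(y in [set x]) k y [set x])).
  rewrite (@eq_integral _ _ _ _ _ (cst (k x [set x]))); last first.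
    by move=> y; rewrite inE => ->.
  by rewrite integral_cst// muleC; apply: lee_wpmul2r.
by apply: ge0_subset_integral => //; exact: measurable_kernel.
Qed.

Lemma arb_kernel_set1 lambda (q a : T -> T -> R) (P : R.-pker T ~> T) x :
  is_arb_kernel lambda q a P ->
  measurable_fun [set: T] (a x) -> measurable_fun [set: T] (q x) ->
  measurable [set x] -> lambda [set x] = 0 ->
  P x [set x] = 1 - acceptance_prob lambda q a x.
Proof.
move=> arbP ma mq mx x0; rewrite arbP// null_set_integral//.
  by rewrite add0e diracE mem_set// mul1e.
apply/measurable_EFinP; apply: measurable_funTS.
exact: measurable_funM.
Qed.

End total_variation_lower_bound.

Theorem theorem1 (R : realType) (Omega : ptopologicalType)
    (lambda : {sigma_finite_measure set (borelType Omega) -> \bar R})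
    (Pi : probability (borelType Omega) R) (pi : borelType Omega -> R)
    (Theta : set (borelType Omega))
    (Q : borelType Omega -> probability (borelType Omega) R)
    (q a : borelType Omega -> borelType Omega -> R)
    (P : R.-pker (borelType Omega) ~> (borelType Omega))
    (Theta_measurable : measurable Theta) (Theta_neq0 : Theta !=set0)
    (Pi_Theta : Pi Theta = 1)
    (pi_density : is_density lambda Pi pi)
    (pi_support : [set theta | (0 < pi theta)%R] = Theta)
    (lambda_singleton : forall theta, Theta theta ->
      measurable [set theta] /\ lambda [set theta] = 0)
    (lambda_positive : forall U : set Omega,
      open U -> measurable (U : set (borelType Omega)) ->
      U !=set0 -> U `<=` Theta -> 0 < lambda U)
    (q_density : forall theta, is_density lambda (Q theta) (q theta))
    (a_bound : forall theta theta', (0 <= a theta theta' <= 1)%R)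
    (a_measurable : forall theta,
      measurable_fun [set: borelType Omega] (a theta))
    (P_arb : is_arb_kernel lambda q a P)
    (Pi_invariant : invariant_measure P Pi)
    (t : nat) (t_gt0 : (0 < t)%N)
    (theta : borelType Omega) (theta_Theta : Theta theta) :
  (1 - acceptance_prob lambda q a theta) ^+ t
    <= tv_dist (kernel_pow P t theta) Pi.
Proof.
have [mtheta theta0] := lambda_singleton theta theta_Theta.
have [mq _ _] := q_density theta.
rewrite -(arb_kernel_set1 P_arb (a_measurable theta) mq mtheta theta0).
apply: le_trans (kernel_pow_set1_ge P t mtheta) _.
apply: le_trans (tv_dist_ge_event _ Pi mtheta).
by rewrite (is_density_null pi_density mtheta theta0) sube0.
Qed.
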